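(* Fix a digraph $D$ with $m:=|E(D)|$ arcs. Let $(\Omega,\mathcal F,\mu)$ be a standard probability space. If $h,h_n:\Omega^2\to[0,1]$ ($n\ge1$) are kernels and $\|h_n-h\|_{L^1(\mu\otimes\mu)}\to0$ as $n\to\infty$, then $U_D(h_n)\to U_D(h)$.
   Context: A digraph is a finite directed simple loopless graph: at most one arc for each ordered pair of distinct vertices (opposite arcs are allowed). A kernel on a probability space $(\Omega,\mathcal F,\mu)$ is a measurable function $h:\Omega^2\to[0,1]$ (not necessarily symmetric). For a finite digraph $D$ with vertex set $\{v_1,\dots,v_N\}$ and arc set $E(D)$, $$U_D(h):=\int_{\Omega^N}\prod_{(v_i,v_j)\in E(D)}h(x_i,x_j)\,d\mu(x_1)\cdots d\mu(x_N).$$ *)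

(* Defs.v *)
From HB Require Import structures.
From mathcomp Require Import all_boot all_order all_algebra.
From mathcomp Require Import all_classical all_reals all_analysis.
Set Implicit Arguments.
Unset Strict Implicit.
Unset Printing Implicit Defensive.
Import Order.TTheory GRing.Theory Num.Theory.
Import numFieldNormedType.Exports.
Local Open Scope classical_set_scope.
Local Open Scope ring_scope.

Record digraph := Digraph {
  vertex :> finType;
  arc : rel vertex;
  arc_irrefl : irreflexive arc }.

Definition arcs (D : digraph) : {set D * D} :=
  [set a : D * D | arc a.1 a.2]%SET.

(* A standard probability space is a standard Borel space with a probability
   measure on it; the sigma-algebra is not completed.  A Hausdorff complete
   pseudometric space is a complete metric space, so X below is Polish, and f
   is an isomorphism onto X with its Borel sigma-algebra. *)
Definition standard_borel (R : realType) d (Omega : measurableType d) : Prop :=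
  exists (X : completePseudoMetricType R) (f : Omega -> X),
    [/\ hausdorff_space X,
        exists2 S : set X, countable S & dense S,
        bijective f &
        @measurable d Omega = preimage_set_system setT f <<s @open X >>].

Section power_probability.
Context d (Omega : measurableType d) (R : realType).
Implicit Type mu : probability Omega R.

Definition cons_pair n (p : Omega * n.-tuple Omega) : n.+1.-tuple Omega :=
  [tuple of p.1 :: p.2].

Lemma measurable_cons_pair n : measurable_fun setT (@cons_pair n).
Proof. exact: measurable_cons measurable_fst measurable_snd. Qed.

HB.instance Definition _ n := isMeasurableFun.Build _ _ _ _ (@cons_pair n)
  (@measurable_cons_pair n).

Section step.
Context (n : nat) (mu : probability Omega R)
  (nu : probability (n.-tuple Omega) R).

Let prod_setT : (mu \x nu)%E setT = 1%E.
Proof.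
rewrite -setXTT product_measure1E// -[RHS]mule1.
by congr (_ * _)%E; exact: probability_setT.
Qed.

HB.instance Definition _ := Measure_isProbability.Build _ _ _ (mu \x nu)%E
  prod_setT.

Definition power_probability_step : probability (n.+1.-tuple Omega) R :=
  distribution (mu \x nu)%E (@cons_pair n).

End step.

(* The product measure of n copies of mu, on the product sigma-algebra that
   the library puts on n-tuples: the image of mu \x mu^n under cons. *)
Fixpoint power_probability mu n : probability (n.-tuple Omega) R :=
  if n is n'.+1 then power_probability_step mu (power_probability mu n')
  else \d_([tuple] : 0.-tuple Omega).

Lemma power_probability_box mu n (A : 'I_n -> set Omega) :
  (forall i, measurable (A i)) ->
  power_probability mu n [set x | forall i, A i (tnth x i)] =
  (\prod_(i < n) mu (A i))%E.
Proof.
elim: n A => [|n IHn] A mA.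
  by rewrite big_ord0 /= diracE mem_set// => -[].
rewrite big_ord_recl /= /distribution /pushforward.
rewrite -IHn//.
have mB : measurable [set x : n.-tuple Omega |
    forall i, A (lift ord0 i) (tnth x i)].
  rewrite (_ : [set _ | _] =
      \bigcap_(i in setT) ((@tnth n Omega)^~ i @^-1` A (lift ord0 i))).
    apply: fin_bigcap_measurable => // i _.
    by rewrite -[X in measurable X]setTI; exact: measurable_tnth.
  by apply/seteqP; split => [x xA i _|x xA i]; [exact: xA|exact: (xA i)].
rewrite -product_measure1E//; congr (_ _).
apply/seteqP; split=> -[x t] /=.
- move=> H; split=> [|i]; first exact: (H ord0).
  by have := H (lift ord0 i); rewrite tnthS.
- move=> [Hx Ht] i; case: (unliftP ord0 i) => [j ->|->//].
  by rewrite tnthS; exact: Ht.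
Qed.

End power_probability.

Section digraph_density.
Context d (Omega : measurableType d) (R : realType).

Definition kernel01 (h : Omega * Omega -> R) : Prop :=
  measurable_fun setT h /\ forall z, 0 <= h z <= 1.

(* The coordinate of x belonging to the vertex v is the one of index
   enum_rank v. *)
Definition U_ (D : digraph) (mu : probability Omega R)
    (h : Omega * Omega -> R) : R :=
  \int[power_probability mu #|D|]_x
    \prod_(a in arcs D) h (tnth x (enum_rank a.1), tnth x (enum_rank a.2)).

End digraph_density.

(* Main.v *)
Require Import Defs.
From HB Require Import structures.
From mathcomp Require Import all_boot all_order all_algebra.
From mathcomp Require Import all_classical all_reals all_analysis.
From mathcomp Require Import measurable_realfun.
Import Order.TTheory GRing.Theory Num.Theory.
Import numFieldNormedType.Exports.
Local Open Scope classical_set_scope.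
Local Open Scope ring_scope.

(** The map [h |-> U_ D mu h] is Lipschitz for the L^1 norm on kernels, with
    the number of arcs of [D] as Lipschitz constant; convergence of the
    densities follows by squeezing.

    For the Lipschitz bound, the two integrands are products over the arcs of
    factors of absolute value at most 1, so they differ by at most the sum
    over the arcs [(u, v)] of [`|h1 - h2|] at the coordinates of [u] and [v]
    ([ler_norm_prodB]).  A digraph has no loop, so these are two distinct
    coordinates of a point drawn from the product measure, and their joint law
    is [mu \x mu] ([distribution_tnth_pair]).  Each arc thus contributes
    exactly the L^1 distance of the two kernels ([U_lipschitz]). *)

(** The telescoping estimate: replacing the factors one at a time changes the
    product by one difference, multiplied by other factors of norm at most 1. *)
Lemma ler_norm_prodB (R : numDomainType) (I : Type) (r : seq I) (P : pred I)
    (F G : I -> R) :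
  (forall i, P i -> `|F i| <= 1) -> (forall i, P i -> `|G i| <= 1) ->
  `|\prod_(i <- r | P i) F i - \prod_(i <- r | P i) G i| <=
  \sum_(i <- r | P i) `|F i - G i|.
Proof.
move=> F1 G1.
(* The induction also has to carry a bound on one of the partial products. *)
suff [] : `|\prod_(i <- r | P i) F i - \prod_(i <- r | P i) G i| <=
    \sum_(i <- r | P i) `|F i - G i| /\ `|\prod_(i <- r | P i) G i| <= 1 by [].
elim/big_rec3 : _ => [|i s y x Pi [xys y1]].
  by rewrite subrr normr0 normr1.
split; last by rewrite normrM mulr_ile1 ?G1.
rewrite (_ : F i * x - G i * y = (F i - G i) * y + F i * (x - y)); last first.
  by rewrite mulrBl mulrBr [RHS]addrC addrA subrK.
rewrite (le_trans (ler_normD _ _))// !normrM lerD//.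
  by rewrite ler_piMr.
by rewrite (le_trans _ xys)// ler_piMl// F1.
Qed.

Section marginals.
Context d (Omega : measurableType d) (R : realType).
Implicit Type mu : probability Omega R.

(** Naming the projection lets it carry the structure of a measurable function,
    so that its distribution is available as a probability measure. *)
Definition tnth_pair n (i j : 'I_n) (x : n.-tuple Omega) : Omega * Omega :=
  (tnth x i, tnth x j).

Lemma measurable_tnth_pair n (i j : 'I_n) :
  measurable_fun setT (tnth_pair n i j).
Proof. by apply: measurable_fun_pair; exact: measurable_tnth. Qed.

HB.instance Definition _ n (i j : 'I_n) :=
  isMeasurableFun.Build _ _ _ _ (tnth_pair n i j) (measurable_tnth_pair n i j).

(** Both sides are finite measures, so it is enough to compare them on
    rectangles [A `*` B].  There the left-hand side is the measure of a box
    whose sides are all full except the [i]-th and the [j]-th; distinctness of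
    [i] and [j] makes these two constraints independent. *)
Lemma distribution_tnth_pair mu n (i j : 'I_n) (X : set (Omega * Omega)) :
  i != j -> measurable X ->
  distribution (power_probability mu n) (tnth_pair n i j) X = (mu \x mu)%E X.
Proof.
move=> ij mX; apply/esym.
apply: (@product_measure_unique _ _ _ _ _ mu mu) => // A B mA mB.
pose C k := if k == i then A else if k == j then B else setT.
have ji : j != i by rewrite eq_sym.
transitivity (power_probability mu n [set x | forall k, C k (tnth x k)]).
  rewrite /distribution /pushforward.
  apply: (congr1 (power_probability mu n)).
  apply/seteqP; split => [x [Ax Bx] k|x Cx]; rewrite /C.
    by case: eqP => [->//|_]; case: eqP => [->|].
  by split; [have := Cx i|have := Cx j]; rewrite /C ?eqxx ?(negbTE ji).
rewrite power_probability_box; last first.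
  by move=> k; rewrite /C; case: ifP => // _; case: ifP.
rewrite (bigD1 i)//= (bigD1 j)//= big1 ?mule1 => [|k /andP[ki kj]].
  by rewrite /C !eqxx (negbTE ji).
by rewrite /C (negbTE ki) (negbTE kj); exact: probability_setT.
Qed.

Lemma ge0_integral_tnth_pair mu n (i j : 'I_n) (g : Omega * Omega -> \bar R) :
  i != j -> measurable_fun setT g -> (forall z, 0 <= g z)%E ->
  (\int[power_probability mu n]_x g (tnth x i, tnth x j) =
   \int[(mu \x mu)]_z g z)%E.
Proof.
move=> ij mg g0.
rewrite -(@eq_measure_integral _ _ _ setT (mu \x mu)%E
  (distribution (power_probability mu n) (tnth_pair n i j))); last first.
  by move=> X mX _; exact: distribution_tnth_pair.
by rewrite ge0_integral_pushforward.
Qed.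

Lemma kernel01_norm_le1 (h : Omega * Omega -> R) z : kernel01 h -> `|h z| <= 1.
Proof. by move=> [_ /(_ z)/andP[h0 h1]]; rewrite ger0_norm. Qed.

Section density_lipschitz.
Variables (D : digraph) (mu : probability Omega R).

Let prod_arcs (h : Omega * Omega -> R) (x : #|D|.-tuple Omega) :=
  \prod_(a in arcs D) h (tnth x (enum_rank a.1), tnth x (enum_rank a.2)).

Let prod_arcs_integrable h : kernel01 h ->
  (power_probability mu #|D|).-integrable setT (EFin \o prod_arcs h).
Proof.
move=> hk; apply: measurable_bounded_integrable => //.
- by rewrite (le_lt_trans (probability_le1 _ _))// ltry.
- rewrite /prod_arcs; under eq_fun do rewrite -big_filter.
  apply: measurable_prod => a _.
  by apply: measurableT_comp; [exact: hk.1|exact: measurable_tnth_pair].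
- exists 1; split; first exact: num_real.
  move=> M M1 x _; rewrite /= (le_trans _ (ltW M1))// normr_prod.
  apply: prodr_ile1 => a _; rewrite normr_ge0 /=.
  exact: kernel01_norm_le1.
Qed.

(** The product integrands are compared arc by arc, and the loop-freeness of
    [D] turns each term into an integral over [mu \x mu].  The inequality is
    between extended reals because nonnegative functions can be integrated
    there, compared and summed, by measurability alone. *)
Lemma U_lipschitz (h1 h2 : Omega * Omega -> R) :
  kernel01 h1 -> kernel01 h2 ->
  ((`|U_ D mu h1 - U_ D mu h2|%R)%:E <=
   #|arcs D|%:R%:E * Lnorm (mu \x mu)%E 1%E (EFin \o (h1 \- h2)%R))%E.
Proof.
move=> hk1 hk2; rewrite Lnorm1.
have i1 := prod_arcs_integrable _ hk1; have i2 := prod_arcs_integrable _ hk2.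
have i12 := integrableB measurableT i1 i2.
have mh : measurable_fun setT (fun z => (`|h1 z - h2 z|)%:E).
  apply/measurable_EFinP; apply: measurableT_comp => //.
  exact: measurable_funB hk1.1 hk2.1.
rewrite /U_ -RintegralB//.
pose g (a : D * D) (x : #|D|.-tuple Omega) :=
  let z := (tnth x (enum_rank a.1), tnth x (enum_rank a.2)) in
  (`|h1 z - h2 z|)%:E.
have mg a : measurable_fun setT (g a).
  apply: (measurableT_comp mh); exact: measurable_tnth_pair.
have <- : (\int[power_probability mu #|D|]_x (\sum_(a in arcs D) g a x) =
   #|arcs D|%:R%:E * \int[(mu \x mu)]_z `|(EFin \o (h1 \- h2)%R) z|)%E.
  under eq_integral do rewrite -big_filter.
  rewrite ge0_integral_sum// => [|a x _]; last by rewrite lee_fin.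
  (* The multiple of an extended real by a natural number is convertible to the
     generic one of additive monoids, to which the lemma on sums applies. *)
  rewrite big_filter mule_natl -[RHS]/(GRing.natmul _ _) -sumr_const.
  apply: eq_bigr => -[u v].
  rewrite inE /= => uv.
  apply: (ge0_integral_tnth_pair mu _ _ _
    (fun z => (`|h1 z - h2 z|)%:E)) => //.
  (* The ends of an arc have distinct coordinates because there is no loop. *)
  apply/eqP => /enum_rank_inj e; move: uv.
  by rewrite (e : u = v) arc_irrefl.
rewrite EFin_normr_Rintegral//.
apply: (le_trans (le_abse_integral _ _ _)) => //.
  exact: measurable_int i12.
apply: ge0_le_integral => //.
- by apply: measurableT_comp => //; exact: measurable_int i12.
- by under eq_fun do rewrite -big_filter; exact: emeasurable_sum.
- move=> x _; rewrite /g sumEFin lee_fin.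
  by apply: ler_norm_prodB => a _; exact: kernel01_norm_le1.
Qed.

End density_lipschitz.

End marginals.

Theorem lemmaB4 (D : digraph) (m : nat) (hm : m = #|arcs D|)
    (R : realType) (d : measure_display) (Omega : measurableType d)
    (hOmega : standard_borel R Omega) (mu : probability Omega R)
    (h : Omega * Omega -> R) (h_ : nat -> Omega * Omega -> R)
    (hk : kernel01 h) (hk_ : forall n : nat, kernel01 (h_ n))
    (hcvg : Lnorm (mu \x mu)%E 1%E (EFin \o (h_ n \- h)) @[n --> \oo] --> 0%E) :
  U_ D mu (h_ n) @[n --> \oo] --> U_ D mu h.
Proof.
move/fine_cvgP : hcvg => [Lfin L0].
apply/subr_cvg0/norm_cvg0P.
apply: (@squeeze_cvgr _ _ _ _ (cst 0) (fun n => #|arcs D|%:R *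
    fine (Lnorm (mu \x mu)%E 1%E (EFin \o (h_ n \- h))))).
- near=> n; rewrite normr_ge0 /= -lee_fin EFinM fineK; last by near: n.
  exact: U_lipschitz.
- exact: cvg_cst.
- by rewrite -[X in _ --> X](mulr0 #|arcs D|%:R); exact: cvgMl_tmp.
Unshelve. all: by end_near. Qed.
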